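(* Let $V_1,V_2,W$ be function systems and let $Q:V_1\to V_2$ be an order quotient map. Then the linear map $Q\otimes \mathrm{id}_W: V_1\otimes_{\max}W\to V_2\otimes_{\max}W$ is an order quotient map.
   Context: A function system is a real vector space $V$ with a (convex) cone $V^+$, $V^+\cap -V^+=\{0\}$ ($v\ge w$ iff $v-w\in V^+$), and an Archimedean order unit $e_V$: for each $v\in V$ there is $r>0$ with $re_V\ge v$, and $\varepsilon e_V+v\in V^+$ for all $\varepsilon>0$ implies $v\in V^+$. A linear map is positive if it maps positive elements to positive elements, unital if it maps order unit to order unit. Order quotient map: a unital positive surjective linear map $T:V\to W$ between function systems such that for any $w\in W^+$ and $\varepsilon>0$ there is $v\in V$ with $v+\varepsilon e_V\in V^+$ and $T(v)=w$. Maximal tensor product: $V\otimes_{\max}W$ is the algebraic tensor product $V\otimes W$ with order unit $e_V\otimes e_W$ and positive cone $(V\otimes_{\max}W)^+=\{z\in V\otimes W: \forall\varepsilon>0,\ z+\varepsilon e_V\otimes e_W\in V^+\otimes W^+\}$, where $V^+\otimes W^+$ is the set of finite sums $\sum_i v_i\otimes w_i$ with $v_i\in V^+$, $w_i\in W^+$. It is a function system. *)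

(* Defs.v *)
From HB Require Import structures.
From mathcomp Require Import all_boot all_order all_algebra.
From mathcomp Require Import boolp classical_sets reals.
From mathcomp.multinomials Require Import freeg.
From mathcomp Require Import ring lra.

Set Implicit Arguments.
Unset Strict Implicit.
Unset Printing Implicit Defensive.

Import Order.TTheory GRing.Theory Num.Theory.

Local Open Scope classical_set_scope.
Local Open Scope ring_scope.

(* [pcone] is V^+ and [ounit] is e_V; that 0 lies in V^+ follows from the
   order unit axiom and closure under nonnegative multiples. *)
HB.mixin Record Lmodule_isFunctionSystem (R : realType) V
    of GRing.Lmodule R V := {
  pcone : set V;
  ounit : V;
  pconeD : forall x y : V, pcone x -> pcone y -> pcone (x + y);
  pconeZ : forall (c : R) (x : V), 0 <= c -> pcone x -> pcone (c *: x);
  pcone_pointed : forall x : V, pcone x -> pcone (- x) -> x = 0;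
  ounit_dominates : forall v : V, exists2 r : R, 0 < r & pcone (r *: ounit - v);
  ounit_archimedean : forall v : V,
    (forall eps : R, 0 < eps -> pcone (eps *: ounit + v)) -> pcone v
}.

#[short(type="functionSystemType")]
HB.structure Definition FunctionSystem (R : realType) :=
  { V of Lmodule_isFunctionSystem R V & GRing.Lmodule R V }.

Arguments ounit {R} s : rename.

Definition unital (R : realType) (V W : functionSystemType R) (T : V -> W) :=
  T (ounit V) = ounit W.

Definition positive (R : realType) (V W : functionSystemType R) (T : V -> W) :=
  forall v : V, pcone v -> pcone (T v).

Definition order_quotient_map (R : realType) (V W : functionSystemType R)
    (T : {linear V -> W}) : Prop :=
  [/\ unital T, positive T, (forall w : W, exists v : V, T v = w) &
    forall (w : W) (eps : R), pcone w -> 0 < eps ->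
      exists v : V, pcone (v + eps *: ounit V) /\ T v = w].

(* The quotient of the free module on V * W by the submodule spanned by the
   bilinearity relations. *)
Section Tensor.
Variables (R : realType) (V W : lmodType R).

Notation free := {freeg (V * W)%type / R}.
Notation gen v w := (<< (v, w) >> : free).

Inductive bilinear_span : free -> Prop :=
| bilinear_span0 : bilinear_span 0
| bilinear_spanl b a v v' w x : bilinear_span x ->
    bilinear_span
      (b *: (gen (a *: v + v') w - (a *: gen v w + gen v' w)) + x)
| bilinear_spanr b a v w w' x : bilinear_span x ->
    bilinear_span
      (b *: (gen v (a *: w + w') - (a *: gen v w + gen v w')) + x).

Definition bilinear_rel : {pred free} := fun x => `[< bilinear_span x >].

Lemma bilinear_relP x : x \in bilinear_rel <-> bilinear_span x.
Proof. by split=> [/asboolP//|?]; apply/asboolP. Qed.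

Lemma bilinear_spanD x y :
  bilinear_span x -> bilinear_span y -> bilinear_span (x + y).
Proof.
elim=> [|b a v v' w z _ IH|b a v w w' z _ IH] hy; rewrite ?add0r// -addrA.
- by apply: bilinear_spanl; exact: IH.
- by apply: bilinear_spanr; exact: IH.
Qed.

Lemma bilinear_spanZ c x : bilinear_span x -> bilinear_span (c *: x).
Proof.
elim=> [|b a v v' w z _ IH|b a v w w' z _ IH].
- by rewrite scaler0; constructor.
- by rewrite scalerDr scalerA; apply: bilinear_spanl.
- by rewrite scalerDr scalerA; apply: bilinear_spanr.
Qed.

Lemma bilinear_rel_zmod_closed : zmod_closed bilinear_rel.
Proof.
split; first by apply/bilinear_relP; constructor.
move=> x y /bilinear_relP hx /bilinear_relP hy; apply/bilinear_relP.
by rewrite -scaleN1r; apply: bilinear_spanD => //; apply: bilinear_spanZ.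
Qed.

HB.instance Definition _ :=
  GRing.isZmodClosed.Build free bilinear_rel bilinear_rel_zmod_closed.

Definition tensor : Type := Quotient.quot bilinear_rel.

HB.instance Definition _ := GRing.Zmodule.on tensor.

Definition tensor_class (x : free) : tensor :=
  \pi_(Quotient.quot bilinear_rel)%qT x.

Definition tensor_repr (z : tensor) : free :=
  repr (z : Quotient.quot bilinear_rel).

Lemma tensor_reprK z : tensor_class (tensor_repr z) = z.
Proof. exact: reprK. Qed.

Lemma tensor_classP x y :
  tensor_class x = tensor_class y <-> bilinear_span (x - y).
Proof.
rewrite -bilinear_relP (Quotient.idealrBE bilinear_rel).
by split=> [/eqP|/eqP].
Qed.

Lemma tensor_classD x y :
  tensor_class (x + y) = tensor_class x + tensor_class y.
Proof. exact: (Quotient.pi_add bilinear_rel). Qed.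

Definition pure (v : V) (w : W) : tensor := tensor_class (gen v w).

Definition tensor_scale (c : R) (z : tensor) : tensor :=
  tensor_class (c *: tensor_repr z).

Lemma tensor_scale_class c x :
  tensor_scale c (tensor_class x) = tensor_class (c *: x).
Proof.
apply/tensor_classP; rewrite -scalerBr; apply: bilinear_spanZ.
by apply/tensor_classP; rewrite tensor_reprK.
Qed.

Lemma tensor_scaleA a b z :
  tensor_scale a (tensor_scale b z) = tensor_scale (a * b) z.
Proof. by rewrite -(tensor_reprK z) !tensor_scale_class scalerA. Qed.

Lemma tensor_scale1 : left_id 1 tensor_scale.
Proof. by move=> z; rewrite -(tensor_reprK z) tensor_scale_class scale1r. Qed.

Lemma tensor_scaleDr : right_distributive tensor_scale +%R.
Proof.
move=> c x y; rewrite -(tensor_reprK x) -(tensor_reprK y) -tensor_classD.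
by rewrite !tensor_scale_class scalerDr tensor_classD.
Qed.

Lemma tensor_scaleDl z : {morph tensor_scale^~ z : a b / a + b}.
Proof.
move=> a b; rewrite -(tensor_reprK z) !tensor_scale_class scalerDl.
by rewrite tensor_classD.
Qed.

HB.instance Definition _ := GRing.Zmodule_isLmodule.Build R tensor
  tensor_scaleA tensor_scale1 tensor_scaleDr tensor_scaleDl.

Lemma tensor_classZ c x : tensor_class (c *: x) = c *: tensor_class x.
Proof. by rewrite -tensor_scale_class. Qed.

Lemma pure_linearl w : linear (pure^~ w).
Proof.
move=> a v v'; rewrite /pure -tensor_classZ -tensor_classD; apply/tensor_classP.
rewrite -[X in bilinear_span X]scale1r -[X in bilinear_span X]addr0.
by apply: bilinear_spanl; constructor.
Qed.

Lemma pure_linearr v : linear (pure v).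
Proof.
move=> a w w'; rewrite /pure -tensor_classZ -tensor_classD; apply/tensor_classP.
rewrite -[X in bilinear_span X]scale1r -[X in bilinear_span X]addr0.
by apply: bilinear_spanr; constructor.
Qed.

HB.instance Definition _ v := GRing.isLinear.Build R W tensor _ (pure v)
  (pure_linearr v).

Lemma pureDl v v' w : pure (v + v') w = pure v w + pure v' w.
Proof. by have := pure_linearl w 1 v v'; rewrite !scale1r. Qed.

Lemma pure0l w : pure 0 w = 0.
Proof. by apply: (@addrI _ (pure 0 w)); rewrite -pureDl !addr0. Qed.

Lemma pureZl a v w : pure (a *: v) w = a *: pure v w.
Proof. by have := pure_linearl w a v 0; rewrite pure0l !addr0. Qed.

Lemma pureNl v w : pure (- v) w = - pure v w.
Proof. by rewrite -scaleN1r pureZl scaleN1r. Qed.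

Lemma pureDr v w w' : pure v (w + w') = pure v w + pure v w'.
Proof. exact: linearD. Qed.

Lemma pure0r v : pure v 0 = 0.
Proof. exact: linear0. Qed.

Lemma pureZr a v w : pure v (a *: w) = a *: pure v w.
Proof. exact: linearZ. Qed.

Lemma tensor_sumP z :
  exists s : seq (V * W), z = \sum_(p <- s) pure p.1 p.2.
Proof.
suff H (x : free) :
    exists s : seq (V * W), tensor_class x = \sum_(p <- s) pure p.1 p.2.
  by have [s Es] := H (tensor_repr z); exists s; rewrite -Es tensor_reprK.
rewrite -[x]freeg_sumE; elim: (dom x) => [|p l [s IH]].
  exists [::]; rewrite !big_nil.
  by rewrite -(scale0r (0 : free)) tensor_classZ scale0r.
exists ((coeff p x *: p.1, p.2) :: s).
rewrite !big_cons tensor_classD IH /= pureZl; congr (_ + _).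
rewrite /pure -tensor_classZ; congr tensor_class.
apply/eqP/freeg_eqP => q; rewrite coeffZ !coeffU.
by case: p => a b /=; rewrite mul1r.
Qed.

End Tensor.

Section FreeLift.
Variables (R : realType) (K : choiceType) (U : lmodType R) (f : K -> U).

Lemma fglift_linear : linear (fglift f : {freeg K / R} -> U).
Proof.
have sub := lift_is_additive f.
have f0 : fglift f 0 = 0 by rewrite -(subrr 0) sub subrr.
have fD x y : fglift f (x + y) = fglift f x + fglift f y.
  have fN : fglift f (- y) = - fglift f y by rewrite -[- y]sub0r sub f0 sub0r.
  by rewrite -[y in LHS]opprK sub fN opprK.
have fS (I : Type) (s : seq I) (F : I -> {freeg K / R}) :
    fglift f (\sum_(i <- s) F i) = \sum_(i <- s) fglift f (F i).
  exact: (big_morph (fglift f) fD f0).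
move=> c x y; rewrite fD; congr (_ + _).
rewrite -[X in _ = c *: fglift f X]freeg_sumE fS scaler_sumr.
rewrite -[X in c *: X]freeg_sumE scaler_sumr fS; apply: eq_bigr => k _.
suff -> : c *: << coeff k x *g k >> = << c * coeff k x *g k >>.
  by rewrite !liftU scalerA.
by apply/eqP/freeg_eqP => q; rewrite coeffZ !coeffU mulrA.
Qed.

HB.instance Definition _ := GRing.isLinear.Build R {freeg K / R} U _
  (fglift f) fglift_linear.

End FreeLift.

Section TensorLift.
Variables (R : realType) (V W U : lmodType R) (B : V -> W -> U).

(* Meaningful only when [B] is bilinear. *)
Definition tensor_lift (z : tensor V W) : U :=
  fglift (fun p : V * W => B p.1 p.2) (tensor_repr z).

Hypothesis Bl : forall w, linear (B^~ w).
Hypothesis Br : forall v, linear (B v).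

Lemma tensor_lift_class x :
  tensor_lift (tensor_class x) = fglift (fun p : V * W => B p.1 p.2) x.
Proof.
have /tensor_classP H : tensor_class (tensor_repr (tensor_class x)) =
  tensor_class x by rewrite tensor_reprK.
apply/eqP; rewrite -subr_eq0 -linearB /=; apply/eqP.
elim: H => [|b a v v' w y _ IH|b a v w w' y _ IH]; first exact: linear0.
- by rewrite linearP /= IH linearB linearP /= !liftU !scale1r Bl subrr scaler0 addr0.
- by rewrite linearP /= IH linearB linearP /= !liftU !scale1r Br subrr scaler0 addr0.
Qed.

Lemma tensor_lift_pure v w : tensor_lift (pure v w) = B v w.
Proof. by rewrite tensor_lift_class liftU scale1r. Qed.

Lemma tensor_lift_linear : linear tensor_lift.
Proof.
move=> a x y; rewrite -(tensor_reprK x) -(tensor_reprK y).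
by rewrite -tensor_classZ -tensor_classD !tensor_lift_class linearP.
Qed.

Definition tensor_lift_lin : {linear tensor V W -> U} := HB.pack tensor_lift
  (GRing.isLinear.Build R (tensor V W) U _ tensor_lift tensor_lift_linear).

Lemma tensor_lift_unique (g : {linear tensor V W -> U}) :
  (forall v w, g (pure v w) = B v w) -> g =1 tensor_lift.
Proof.
move=> gB z; have [s ->] := tensor_sumP z.
rewrite linear_sum -[tensor_lift]/(tensor_lift_lin : _ -> _) linear_sum.
by apply: eq_bigr => p _; rewrite gB /= tensor_lift_pure.
Qed.

End TensorLift.

Section TensorMap.
Variables (R : realType) (V V' W W' : lmodType R).
Variables (f : {linear V -> V'}) (g : {linear W -> W'}).

Definition tensor_map : tensor V W -> tensor V' W' :=
  tensor_lift (fun v w => pure (f v) (g w)).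

Fact tensor_map_bilinearl w : linear (fun v => pure (f v) (g w)).
Proof. by move=> a v v'; rewrite linearP pure_linearl. Qed.

Fact tensor_map_bilinearr v : linear (fun w => pure (f v) (g w)).
Proof. by move=> a w w'; rewrite linearP linearP. Qed.

HB.instance Definition _ := GRing.isLinear.Build R _ _ _ tensor_map
  (tensor_lift_linear tensor_map_bilinearl tensor_map_bilinearr).

Lemma tensor_map_pure v w : tensor_map (pure v w) = pure (f v) (g w).
Proof. exact: tensor_lift_pure tensor_map_bilinearl tensor_map_bilinearr _ _. Qed.

End TensorMap.

Section ScalarFunctional.
Variables (R : realType) (U : lmodType R) (g : U -> R).
Hypothesis gl : scalar g.

Lemma scalar_fun0 : g 0 = 0.
Proof. by have := gl (-1) 0 0; rewrite scaler0 add0r mulN1r addNr. Qed.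

Lemma scalar_funD x y : g (x + y) = g x + g y.
Proof. by have := gl 1 x y; rewrite scale1r mul1r. Qed.

Lemma scalar_funZ c x : g (c *: x) = c * g x.
Proof. by have := gl c x 0; rewrite scalar_fun0 !addr0. Qed.

Lemma scalar_funN x : g (- x) = - g x.
Proof. by rewrite -scaleN1r scalar_funZ mulN1r. Qed.

Lemma scalar_fun_sum (I : Type) (s : seq I) (F : I -> U) :
  g (\sum_(i <- s) F i) = \sum_(i <- s) g (F i).
Proof. exact: (big_morph g scalar_funD scalar_fun0). Qed.

End ScalarFunctional.

Section FunctionSystemTheory.
Variables (R : realType) (V : functionSystemType R).
Local Notation e := (ounit V).
Local Notation C := (@pcone R V).

Lemma pcone0 : C 0.
Proof.
have [r _ h] := ounit_dominates e.
by rewrite -(scale0r (r *: e - e)); apply: pconeZ.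
Qed.

Lemma pcone_ounit : C e.
Proof.
have [r r0 h] := ounit_dominates (0 : V).
have -> : e = r^-1 *: (r *: e - 0).
  by rewrite subr0 scalerA mulVf ?scale1r// gt_eqF.
by apply: pconeZ; rewrite ?invr_ge0 ?ltW.
Qed.

Lemma pcone_sum (I : eqType) (s : seq I) (F : I -> V) :
  (forall i, i \in s -> C (F i)) -> C (\sum_(i <- s) F i).
Proof.
elim: s => [|i s IH] h; first by rewrite big_nil; exact: pcone0.
rewrite big_cons; apply: pconeD; first by apply: h; rewrite mem_head.
by apply: IH => j js; apply: h; rewrite inE js orbT.
Qed.

Lemma ounit_dominates_sym (v : V) :
  exists r : R, [/\ 0 < r, C (r *: e - v) & C (r *: e + v)].
Proof.
have [r r0 h] := ounit_dominates v; have [t t0 k] := ounit_dominates (- v).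
rewrite opprK in k; exists (r + t); split; first exact: addr_gt0.
- by rewrite scalerDl addrAC; apply: pconeD => //;
    apply: pconeZ (ltW t0) pcone_ounit.
- by rewrite scalerDl -addrA; apply: pconeD => //;
    apply: pconeZ (ltW r0) pcone_ounit.
Qed.

Definition positive_functional (f : V -> R) :=
  scalar f /\ forall x, C x -> 0 <= f x.

Lemma maximal_cone (u : V) : ~ C u ->
  exists A : set V, [/\ (forall x y, A x -> A y -> A (x + y)),
    (forall (c : R) x, 0 <= c -> A x -> A (c *: x)),
    C `<=` A, A (- u) & ~ A (- e) /\ forall x, A x \/ A (- x)].
Proof.
move=> nCu.
pose nice (A : set V) := [/\ (forall x y, A x -> A y -> A (x + y)),
    (forall (c : R) x, 0 <= c -> A x -> A (c *: x)),
    C `<=` A, A (- u) & ~ A (- e)].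
have adj (A : set V) (x : V) :
    (forall x y, A x -> A y -> A (x + y)) ->
    (forall (c : R) x, 0 <= c -> A x -> A (c *: x)) -> A 0 ->
    let B := [set y | exists d s, [/\ A d, 0 <= s & y = d + s *: x]] in
    [/\ (forall x y, B x -> B y -> B (x + y)),
    (forall (c : R) x, 0 <= c -> B x -> B (c *: x)), A `<=` B & B x].
  move=> AD AZ A0 B; split.
  - move=> _ _ [d [s [Ad s0 ->]]] [d' [s' [Ad' s0' ->]]].
    exists (d + d'), (s + s'); split; [exact: AD|exact: addr_ge0|].
    by rewrite scalerDl addrACA.
  - move=> c _ c0 [d [s [Ad s0 ->]]]; exists (c *: d), (c * s).
    by split; [exact: AZ|exact: mulr_ge0|rewrite scalerDr scalerA].
  - by move=> d Ad; exists d, 0; split=> //; rewrite scale0r addr0.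
  - by exists 0, 1; split=> //; rewrite add0r scale1r.
have nice0 : exists A, nice A.
  have [BD BZ CB Bu] := adj C (- u) (@pconeD R V) (@pconeZ R V) pcone0.
  exists [set y | exists d s, [/\ C d, 0 <= s & y = d + s *: (- u)]].
  split=> // -[d [s [Cd]]]; rewrite le_eqVlt => /predU1P[<-|s0] E.
    apply: nCu; rewrite scale0r addr0 in E.
    have e0 : e = 0.
      by apply: pcone_pointed; [exact: pcone_ounit|rewrite E].
    have [r _] := ounit_dominates (- u).
    by rewrite e0 scaler0 add0r opprK.
  apply: nCu; have -> : u = s^-1 *: (d + e).
    have -> : d + e = s *: u.
      by rewrite -[e]opprK E scalerN opprB addrC subrK.
    by rewrite scalerA mulVf ?scale1r// gt_eqF.
  apply: pconeZ; first by rewrite invr_ge0 ltW.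
  by apply: pconeD => //; exact: pcone_ounit.
have [|A [PA maxA]] := @Zorn_bigcup V [set A | A = set0 \/ nice A].
  move=> F FP Ftot /=.
  have [[X FX Xn0]|Fn0] := pselect (exists2 X, F X & X <> set0); last first.
    left; rewrite -subset0 => x [X FX Xx]; apply: Fn0; exists X => // X0.
    by rewrite X0 in Xx.
  right.
  have niceF Y y : F Y -> Y y -> nice Y.
    move=> FY Yy; case: (FP _ FY) => // Y0.
    by rewrite Y0 in Yy.
  have nX : nice X by case: (FP _ FX).
  have [_ _ CX uX _] := nX.
  split.
  - move=> x y [Y FY Yx] [Z FZ Zy].
    have [YZ|ZY] := Ftot _ _ FY FZ.
      by exists Z => //; have [ZD _ _ _ _] := niceF _ _ FZ Zy; apply: ZD => //;
        exact: YZ.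
    by exists Y => //; have [YD _ _ _ _] := niceF _ _ FY Yx; apply: YD => //;
      exact: ZY.
  - move=> c x c0 [Y FY Yx]; exists Y => //.
    by have [_ YZ _ _ _] := niceF _ _ FY Yx; apply: YZ.
  - by move=> x Cx; exists X => //; exact: CX.
  - by exists X.
  - by move=> [Y FY Ye]; have [_ _ _ _] := niceF _ _ FY Ye.
have nA : nice A.
  case: PA => // A0; have [B nB] := nice0.
  exfalso; apply: (maxA B); last by right.
  rewrite A0; split; first exact: sub0set.
  by move=> /(_ (- u)) H; have [_ _ _ Bu _] := nB; exact: H.
have [AD AZ CA Au nAe] := nA.
exists A; split=> //; split=> // x.
have ext y : ~ A y -> exists d s, [/\ A d, 0 < s & - e = d + s *: y].
  move=> nAy.
  have [BD BZ AB By] := adj A y AD AZ (CA _ pcone0).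
  set B := [set _ | _] in BD BZ AB By.
  have Be : B (- e).
    apply: contrapT => nBe; apply: (maxA B).
      by split=> // BA; apply: nAy; exact: BA.
    by right; split=> // [z Cz|]; apply: AB => //; exact: CA.
  have [d [s [Ad s0 E]]] := Be; exists d, s; split=> //.
  rewrite lt_neqAle s0 andbT; apply/eqP => s00.
  by apply: nAe; rewrite E -s00 scale0r addr0.
have [Ax|nAx] := pselect (A x); first by left.
have [Ax|nAx'] := pselect (A (- x)); first by right.
exfalso; apply: nAe.
have [d [s [Ad s0 E]]] := ext _ nAx; have [d' [t [Ad' t0 E']]] := ext _ nAx'.
have -> : - e = (s + t)^-1 *: (t *: d + s *: d').
  have -> : t *: d + s *: d' = (s + t) *: - e.
    rewrite scalerDl {1}E' E !scalerDr !scalerN !scalerA [t * s]mulrC.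
    by rewrite addrACA addNr addr0 addrC.
  by rewrite scalerA mulVf ?scale1r// gt_eqF// addr_gt0.
apply: (AZ); first by rewrite invr_ge0 ltW// addr_gt0.
by apply: (AD); apply: (AZ) => //; exact: ltW.
Qed.

Lemma positive_functional_sep (v : V) : ~ C v ->
  exists f, positive_functional f /\ f v < 0.
Proof.
move=> nCv.
have [eps eps0 nCu] : exists2 eps : R, 0 < eps & ~ C (eps *: e + v).
  apply: contrapT => H; apply: nCv; apply: ounit_archimedean => eps eps0.
  by apply: contrapT => H'; apply: H; exists eps.
have [A [AD AZ CA Au [nAe Atot]]] := maximal_cone nCu.
pose S x := [set t : R | A (x - t *: e)].
pose f x := sup (S x).
have Age t : A (t *: - e) -> t <= 0.
  rewrite leNgt => At; apply/negP => t0; apply: nAe.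
  have -> : - e = t^-1 *: (t *: - e) by rewrite scalerA mulVf ?scale1r// gt_eqF.
  by apply: (AZ) => //; rewrite invr_ge0 ltW.
have Sub x : has_ubound (S x).
  have [r r0 h] := ounit_dominates x; exists r => t Sxt.
  rewrite -subr_le0; apply: (Age); rewrite scalerN -scaleNr opprB scalerBl.
  have -> : r *: e - t *: e = (r *: e - x) + (x - t *: e) by rewrite addrA subrK.
  by apply: (AD) => //; exact: CA.
have Sn0 x : S x !=set0.
  have [r r0 h] := ounit_dominates (- x); exists (- r); rewrite /S /=.
  by rewrite scaleNr opprK addrC; apply: CA; rewrite opprK in h.
have Sf x t : S x t -> t <= f x by move=> h; apply: (ub_le_sup (Sub x)).
have fS x t : (forall s, S x s -> s <= t) -> f x <= t.
  by move=> h; apply: ge_sup => //; exact: Sn0.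
have fsup x y : f x + f y <= f (x + y).
  rewrite -lerBrDr; apply: (fS) => s Sx; rewrite lerBrDr -lerBrDl.
  apply: (fS) => t Sy; rewrite lerBrDl; apply: (Sf); rewrite /S /=.
  by rewrite scalerDl opprD addrACA; apply: (AD).
have fN x : f (- x) = - f x.
  apply/eqP; rewrite eq_le; apply/andP; split.
    rewrite -subr_le0 opprK; apply: le_trans (fsup _ _) _; rewrite addNr.
    by apply: (fS) => t; rewrite /S /= sub0r -scalerN; exact: Age.
  rewrite lerNl; apply/ler_addgt0Pr => d d0.
  have : S (- x) (- (f x + d)).
    rewrite /S /= scaleNr opprK; have [h|] := Atot (x - (f x + d) *: e).
      by have := Sf _ _ h; rewrite gerDl leNgt d0.
    by rewrite opprB addrC.
  by move=> /Sf; lra.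
have fD x y : f (x + y) = f x + f y.
  apply/eqP; rewrite eq_le fsup andbT.
  by have := fsup (- x) (- y); rewrite -opprD !fN -opprD lerN2.
have fZge c x : 0 < c -> c * f x <= f (c *: x).
  move=> c0; rewrite -ler_pdivlMl//; apply: (fS) => t Sx.
  rewrite ler_pdivlMl//; apply: (Sf); rewrite /S /= -scalerA -scalerBr.
  by apply: (AZ) => //; exact: ltW.
have fZp c x : 0 < c -> f (c *: x) = c * f x.
  move=> c0; apply/eqP; rewrite eq_le fZge// andbT.
  by have := fZge c (- x) c0; rewrite scalerN !fN mulrN lerN2.
have f0 : f 0 = 0 by have := fN 0; rewrite oppr0; lra.
have fZ c x : f (c *: x) = c * f x.
  have [c0|c0|->] := ltgtP c 0; last by rewrite scale0r f0 mul0r.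
    by rewrite -[c]opprK scaleNr fN fZp ?oppr_gt0// !mulNr.
  exact: fZp.
exists f; split; first split.
- by move=> c x y; rewrite fD fZ.
- by move=> x Cx; apply: (Sf); rewrite /S /= scale0r subr0; exact: CA.
have fe : 1 <= f e by apply: (Sf); rewrite /S /= scale1r subrr; exact: CA pcone0.
have fu : 0 <= f (- (eps *: e + v)).
  by apply: (Sf); rewrite /S /= scale0r subr0.
rewrite fN fD fZ in fu; have : eps <= eps * f e by rewrite ler_pMr.
by lra.
Qed.

Lemma positive_functional_eq0 (v : V) :
  (forall f, positive_functional f -> f v = 0) -> v = 0.
Proof.
move=> h; apply: pcone_pointed; apply: contrapT => /positive_functional_sep.
  by move=> [f [pf]]; rewrite (h f pf) ltxx.
by move=> [f [pf]]; rewrite (scalar_funN pf.1) (h f pf) oppr0 ltxx.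
Qed.

End FunctionSystemTheory.

Section MaxTensor.
Variables (R : realType) (V W : functionSystemType R).

Local Notation e := (pure (ounit V) (ounit W)).

(* V^+ \otimes W^+; the archimedean closure is taken in [max_cone]. *)
Definition tensor_cone : set (tensor V W) := [set z |
  exists s : seq (V * W),
    (forall p, p \in s -> pcone p.1 /\ pcone p.2) /\
    z = \sum_(p <- s) pure p.1 p.2].

Definition max_cone : set (tensor V W) := [set z |
  forall eps : R, 0 < eps -> tensor_cone (z + eps *: e)].

Lemma tensor_coneD x y :
  tensor_cone x -> tensor_cone y -> tensor_cone (x + y).
Proof.
move=> [s [hs ->]] [t [ht ->]]; exists (s ++ t); split; last by rewrite big_cat.
by move=> p; rewrite mem_cat => /orP[/hs|/ht].
Qed.

Lemma tensor_coneZ (c : R) x : 0 <= c -> tensor_cone x -> tensor_cone (c *: x).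
Proof.
move=> c0 [s [hs ->]]; exists [seq (c *: p.1, p.2) | p <- s]; split.
  by move=> _ /mapP[p /hs[h1 h2] ->]; split=> //; apply: pconeZ.
by rewrite big_map scaler_sumr; apply: eq_bigr => p _; rewrite pureZl.
Qed.

Lemma tensor_cone_pure v w : pcone v -> pcone w -> tensor_cone (pure v w).
Proof.
move=> hv hw; exists [:: (v, w)]; rewrite big_seq1; split=> // p.
by rewrite inE => /eqP ->.
Qed.

Lemma tensor_cone_unit : tensor_cone e.
Proof. by apply: tensor_cone_pure; exact: pcone_ounit. Qed.

Lemma tensor_cone_max z : tensor_cone z -> max_cone z.
Proof.
move=> hz eps eps0; apply: tensor_coneD => //.
by apply: tensor_coneZ (ltW eps0) tensor_cone_unit.
Qed.

Lemma max_coneD x y : max_cone x -> max_cone y -> max_cone (x + y).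
Proof.
move=> hx hy eps eps0; rewrite [eps]splitr scalerDl addrACA.
by apply: tensor_coneD; [apply: hx|apply: hy]; rewrite divr_gt0.
Qed.

Lemma max_coneZ (c : R) x : 0 <= c -> max_cone x -> max_cone (c *: x).
Proof.
rewrite le_eqVlt => /predU1P[<- _|c0 hx eps eps0].
  rewrite scale0r; apply: tensor_cone_max.
  by exists [::]; rewrite big_nil; split.
have -> : c *: x + eps *: e = c *: (x + (eps / c) *: e).
  by rewrite scalerDr scalerA mulrC divfK// gt_eqF.
by apply: tensor_coneZ (ltW c0) (hx _ _); rewrite divr_gt0.
Qed.

Lemma max_cone_archimedean z :
  (forall eps : R, 0 < eps -> max_cone (eps *: e + z)) -> max_cone z.
Proof.
move=> h eps eps0; have e2 : 0 < eps / 2 by rewrite divr_gt0.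
by have := h _ e2 _ e2; rewrite addrAC -scalerDl -splitr addrC.
Qed.

Lemma max_cone_dominates z : exists2 r : R, 0 < r & max_cone (r *: e - z).
Proof.
suff [r r0 h] : exists2 r : R, 0 < r & tensor_cone (r *: e - z).
  by exists r => //; exact: tensor_cone_max.
have [s ->] := tensor_sumP z; elim: s => [|[v w] s [r r0 IH]].
  by exists 1; rewrite ?ltr01// big_nil subr0 scale1r; exact: tensor_cone_unit.
have [a [a0 va va']] := ounit_dominates_sym v.
have [b [b0 wb wb']] := ounit_dominates_sym w.
exists (a * b + r); first by rewrite addr_gt0// mulr_gt0.
rewrite big_cons scalerDl opprD addrACA; apply: tensor_coneD => //=.
have -> : (a * b) *: e - pure v w = 2^-1 *:
    (pure (a *: ounit V - v) (b *: ounit W + w) +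
     pure (a *: ounit V + v) (b *: ounit W - w)).
  have -> : pure (a *: ounit V - v) (b *: ounit W + w) +
     pure (a *: ounit V + v) (b *: ounit W - w) =
     2 *: ((a * b) *: e - pure v w).
    have -> : (a * b) *: e = pure (a *: ounit V) (b *: ounit W).
      by rewrite pureZl pureZr scalerA.
    rewrite !pureDl !pureDr !pureNl !linearN addrACA.
    rewrite [X in X + _ = _]addrACA [X in _ + X = _]addrACA.
    by rewrite subrr addr0 addNr add0r addrACA scaler_nat mulr2n.
  by rewrite scalerA mulVf ?scale1r// pnatr_eq0.
apply: tensor_coneZ; first by rewrite invr_ge0.
by apply: tensor_coneD; apply: tensor_cone_pure.
Qed.

Lemma pure_functionals_eq0 (z : tensor V W) :
  (forall (f : V -> R) (g : W -> R),
     positive_functional f -> positive_functional g ->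
     tensor_lift (fun v w => f v * g w : R^o) z = 0) -> z = 0.
Proof.
have ev (f : V -> R) (g : W -> R) (s : seq (V * W)) :
    scalar f -> scalar g ->
    tensor_lift (fun v w => f v * g w : R^o) (\sum_(p <- s) pure p.1 p.2) =
    \sum_(p <- s) f p.1 * g p.2.
  move=> fl gl.
  have Bl w : linear (fun v => f v * g w : R^o).
    by move=> a v v'; rewrite fl mulrDl -mulrA.
  have Br v : linear (fun w => f v * g w : R^o).
    by move=> a w w'; rewrite gl mulrDr mulrCA.
  pose L := tensor_lift_lin Bl Br.
  rewrite -[LHS]/(L _) linear_sum; apply: eq_bigr => p _.
  exact: tensor_lift_pure Bl Br _ _.
move=> h; have [s Es] := tensor_sumP z.
have {h} : forall f g, positive_functional f -> positive_functional g ->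
    \sum_(p <- s) f p.1 * g p.2 = 0.
  by move=> f g pf pg; rewrite -(ev f g s pf.1 pg.1) -Es; exact: h.
rewrite {}Es {z}; have [n] := ubnP (size s).
elim: n s => // n IH [|[v w] s] /=; rewrite ?big_nil// ltnS => sn h.
have [[f [pf fv]]|nf] :=
    pselect (exists f, positive_functional f /\ f v <> 0); last first.
  have v0 : v = 0.
    apply: positive_functional_eq0 => f pf; apply: contrapT => fv.
    by apply: nf; exists f.
  rewrite big_cons /= v0 pure0l add0r; apply: IH => // f g pf pg.
  have := h f g pf pg; rewrite big_cons /= v0.
  by rewrite (scalar_fun0 pf.1) mul0r add0r.
have [fl _] := pf.
have fv0 : f v != 0 by apply/eqP.
have Ew : w = - \sum_(p <- s) (f p.1 / f v) *: p.2.
  have : f v *: w + \sum_(p <- s) f p.1 *: p.2 = 0.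
    apply: positive_functional_eq0 => g pg; have [gl _] := pg.
    rewrite (scalar_funD gl) (scalar_funZ gl) (scalar_fun_sum gl).
    under eq_bigr do rewrite (scalar_funZ gl).
    by have := h f g pf pg; rewrite big_cons.
  move/eqP; rewrite addr_eq0 => /eqP E.
  have -> : w = (f v)^-1 *: (f v *: w) by rewrite scalerA mulVf// scale1r.
  rewrite E scalerN scaler_sumr; congr (- _); apply: eq_bigr => p _.
  by rewrite scalerA mulrC.
pose t := [seq (p.1 - (f p.1 / f v) *: v, p.2) | p <- s].
have -> : \sum_(p <- (v, w) :: s) pure p.1 p.2 = \sum_(p <- t) pure p.1 p.2.
  rewrite big_cons /= big_map Ew linearN linear_sum /= addrC -sumrB.
  by apply: eq_bigr => p _; rewrite pureDl -scaleNr pureZl pureZr scaleNr.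
apply: IH; first by rewrite size_map.
move=> f' g pf' pg; rewrite big_map /=.
have [fl' _] := pf'; have [gl _] := pg.
have := h f' g pf' pg; rewrite big_cons /= Ew.
rewrite (scalar_funN gl) (scalar_fun_sum gl) mulrN mulr_sumr addrC -sumrB.
move=> H; rewrite -[RHS]H; apply: eq_bigr => p _.
rewrite (scalar_funZ gl) (scalar_funD fl') (scalar_funN fl') (scalar_funZ fl').
by rewrite mulrBl mulrA [f' v * _]mulrC.
Qed.

Lemma max_cone_pointed z : max_cone z -> max_cone (- z) -> z = 0.
Proof.
move=> hz hNz; apply: pure_functionals_eq0 => f g [fl fp] [gl gp].
have Bl w : linear (fun v => f v * g w : R^o).
  by move=> a v v'; rewrite fl mulrDl -mulrA.
have Br v : linear (fun w => f v * g w : R^o).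
  by move=> a w w'; rewrite gl mulrDr mulrCA.
pose L := tensor_lift_lin Bl Br.
have Lp x : tensor_cone x -> 0 <= L x.
  move=> [s [hs ->]]; rewrite linear_sum big_seq sumr_ge0// => p /hs[h1 h2].
  rewrite -[L _]/(tensor_lift _ _) tensor_lift_pure//.
  by apply: mulr_ge0; [exact: fp|exact: gp].
have Le : 0 <= L e by apply: Lp; exact: tensor_cone_unit.
have Lmax x : max_cone x -> 0 <= L x.
  move=> hx; rewrite leNgt; apply/negP => Lx.
  have Le1 : 0 < L e + 1 by lra.
  have := Lp _ (hx (- L x / (L e + 1)) _).
  rewrite divr_gt0 ?oppr_gt0// => /(_ isT).
  rewrite linearD linearZ /= -[_ *: _]/(_ * _) => H.
  have : (- L x / (L e + 1)) * L e < - L x.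
    by rewrite mulrAC ltr_pdivrMr// ltr_pM2l ?oppr_gt0// ltrDl.
  by rewrite -subr_gt0 -opprD oppr_gt0 ltNge H.
apply/eqP; rewrite -[tensor_lift _ _]/(L z) eq_le Lmax// andbT.
by have := Lmax _ hNz; rewrite linearN oppr_ge0.
Qed.

Definition max_tensor : Type := tensor V W.

HB.instance Definition _ := GRing.Lmodule.on max_tensor.

HB.instance Definition _ := Lmodule_isFunctionSystem.Build R max_tensor
  max_coneD max_coneZ max_cone_pointed max_cone_dominates max_cone_archimedean.

End MaxTensor.

Definition max_tensor_map (R : realType) (V V' W W' : functionSystemType R)
    (f : {linear V -> V'}) (g : {linear W -> W'}) :
    {linear max_tensor V W -> max_tensor V' W'} :=
  tensor_map f g : {linear tensor V W -> tensor V' W'}.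

(* Main.v *)
Require Import Defs.
From HB Require Import structures.
From mathcomp Require Import all_boot all_order all_algebra.
From mathcomp Require Import boolp classical_sets reals.

Set Implicit Arguments.
Unset Strict Implicit.
Unset Printing Implicit Defensive.

Import Order.TTheory GRing.Theory Num.Theory.

Local Open Scope ring_scope.

(** If [z] lies in the maximal cone, then [z + (eps/2) e] is a finite sum of
    positive elementary tensors, so it suffices to lift those. If [v' + d e] is
    positive, [Q v' = v], [w] is positive and [w <= r e], then [v' (x) w] lifts
    [v (x) w], and adding [d r (e (x) e)] to it gives
    [(v' + d e) (x) w + d e (x) (r e - w)], which lies in the cone. *)

Section TensorMap.
Variables (R : realType) (V V' W W' : lmodType R).
Variables (f : {linear V -> V'}) (g : {linear W -> W'}).

Lemma tensor_map_sum (s : seq (V * W)) :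
  tensor_map f g (\sum_(p <- s) pure p.1 p.2) =
  \sum_(p <- s) pure (f p.1) (g p.2).
Proof. by rewrite linear_sum; apply: eq_bigr => p _; exact: tensor_map_pure. Qed.

(** Every tensor is a finite sum of elementary ones, so it suffices to lift both factors of each
    summand. *)
Lemma tensor_map_surj :
  (forall y, exists x, f x = y) -> (forall y, exists x, g x = y) ->
  forall z, exists x, tensor_map f g x = z.
Proof.
move=> fsurj gsurj z; have [s ->] := tensor_sumP z.
elim: s => [|[v w] s [x Ex]]; first by exists 0; rewrite linear0 big_nil.
have [v' <-] := fsurj v; have [w' <-] := gsurj w.
by exists (pure v' w' + x); rewrite linearD /= Ex big_cons tensor_map_pure.
Qed.

End TensorMap.

Section MaxTensorMap.
Variables (R : realType) (V V' W W' : functionSystemType R).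
Variables (f : {linear V -> V'}) (g : {linear W -> W'}).

Lemma tensor_map_cone z : positive f -> positive g ->
  tensor_cone z -> tensor_cone (tensor_map f g z).
Proof.
move=> fpos gpos [s [hs ->]]; exists [seq (f p.1, g p.2) | p <- s].
rewrite tensor_map_sum big_map; split=> // _ /mapP[p /hs[h1 h2] ->].
by split; [exact: fpos | exact: gpos].
Qed.

Lemma max_tensor_map_unital :
  unital f -> unital g -> unital (max_tensor_map f g).
Proof.
by move=> fu gu; rewrite /unital /= [LHS]tensor_map_pure fu gu.
Qed.

(** Membership in [max_cone] is tested after adding [eps] times the unit; unitality of [f] and [g]
    carries this perturbation to the same one of the image. *)
Lemma max_tensor_map_positive : unital f -> unital g ->
  positive f -> positive g -> positive (max_tensor_map f g).
Proof.
move=> fu gu fpos gpos z hz eps /hz /(tensor_map_cone fpos gpos).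
by rewrite linearD linearZ /= tensor_map_pure fu gu.
Qed.

End MaxTensorMap.

Lemma pure_add_unit_cone (R : realType) (V W : functionSystemType R)
    (v : V) (w : W) (d r : R) :
  0 <= d -> pcone (v + d *: ounit V) -> pcone w -> pcone (r *: ounit W - w) ->
  tensor_cone (pure v w + (d * r) *: pure (ounit V) (ounit W)).
Proof.
move=> d0 hv hw hr.
have -> : pure v w + (d * r) *: pure (ounit V) (ounit W) =
    pure (v + d *: ounit V) w + pure (d *: ounit V) (r *: ounit W - w).
  (* The two copies of [pure (d *: ounit V) w] cancel. *)
  rewrite pureDl linearB /= -addrA; congr (_ + _).
  by rewrite addrC subrK pureZr pureZl scalerA mulrC.
apply: tensor_coneD; apply: tensor_cone_pure => //.
exact: pconeZ d0 (pcone_ounit V).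
Qed.

(** Induction on the number of summands with [eps] arbitrary: half of it pays for the head, half for
    the tail. *)
Lemma tensor_cone_lift (R : realType) (V1 V2 W : functionSystemType R)
    (Q : {linear V1 -> V2}) (z : tensor V2 W) (eps : R) :
  order_quotient_map Q -> tensor_cone z -> 0 < eps ->
  exists x : tensor V1 W,
    tensor_cone (x + eps *: pure (ounit V1) (ounit W)) /\
    tensor_map Q idfun x = z.
Proof.
move=> [_ _ _ Qlift] [s [hs ->]].
elim: s hs eps => [|[v w] s IH] hs eps eps0.
  exists 0; rewrite linear0 big_nil add0r; split=> //.
  by apply: tensor_coneZ (ltW eps0) _; exact: tensor_cone_unit.
have e2 : 0 < eps / 2 by rewrite divr_gt0.
have [|x [hx Ex]] := IH _ _ e2; first by move=> p ps; apply: hs; rewrite inE ps orbT.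
have [hv hw] := hs (v, w) (mem_head _ _).
have [r r0 hr] := ounit_dominates w.
(* Bounding [w] by [r] units multiplies the defect allowed in lifting [v] by [r], so dividing by [r]
   makes the head cost exactly [eps / 2]. *)
have d0 : 0 < eps / 2 / r by rewrite divr_gt0.
have [v' [hv' Ev]] := Qlift v _ hv d0.
exists (pure v' w + x); split.
  rewrite [eps]splitr scalerDl addrACA; apply: tensor_coneD => //.
  rewrite -[X in X *: _](divfK (lt0r_neq0 r0)).
  exact: pure_add_unit_cone (ltW d0) hv' hw hr.
by rewrite linearD /= Ex big_cons tensor_map_pure Ev.
Qed.

Theorem theorem3p9 (R : realType) (V1 V2 W : functionSystemType R)
    (Q : {linear V1 -> V2}) :
  order_quotient_map Q ->
  order_quotient_map
    (max_tensor_map Q (idfun : {linear W -> W}) :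
       {linear max_tensor V1 W -> max_tensor V2 W}).
Proof.
move=> hQ; have [Qu Qpos Qsurj _] := hQ; split.
- exact: max_tensor_map_unital.
- exact: max_tensor_map_positive.
- by apply: tensor_map_surj => // w; exists w.
move=> z eps hz eps0.
(* One half moves [z] into [tensor_cone], the other is spent on lifting. *)
have e2 : 0 < eps / 2 by rewrite divr_gt0.
have [x [hx Ex]] := tensor_cone_lift hQ (hz _ e2) e2.
(* Since [x] lifts [z] plus [eps / 2] units, that excess is subtracted again; unitality of [Q] makes
   it cancel in the image. *)
exists (x - (eps / 2) *: pure (ounit V1) (ounit W)); split.
  apply: tensor_cone_max.
  by rewrite {2}[eps]splitr scalerDl addrA subrK.
rewrite -[LHS]/(tensor_map _ _ _) linearB linearZ /= Ex tensor_map_pure Qu.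
exact: addrK.
Qed.
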